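(* Let the problem $(\mathcal{P})$: minimize $f(x)$ subject to $x \in M$, $x \in Q$, be Levitin-Polyak well-posed in the extended sense. Then the penalty function $F_c = f + c\varphi$ is globally exact if and only if the following three conditions hold true: 1. $F_c$ has the zero duality gap property, i.e. $\sup_{c \ge 0} \inf_{x \in Q} F_c(x) = f_*$; 2. $F_c$ is nondegenerate in the extended sense; 3. $F_c$ is locally exact at every globally optimal solution of the problem $(\mathcal{P})$.
   Context: $(X,d)$ is a metric space, $M,Q \subset X$ are nonempty, $f \colon X \to \mathbb{R}\cup\{+\infty\}$. The feasible region $\Omega = M \cap Q$ is nonempty and the optimal value $f_* = \inf_{x\in\Omega} f(x)$ is finite; $\operatorname{argmin}(\mathcal{P})$ is the set of globally optimal solutions of $(\mathcal{P})$. Notation: $\operatorname{dist}(x,V) = \inf_{y \in V} d(x,y)$. An infeasibility measure (penalty term) for the constraint $x \in M$ on $Q$ is a function $\varphi \colon X \to [0,+\infty]$ such that for any $x \in Q$ one has $\varphi(x)=0 \iff x \in M$; such a $\varphi$ is fixed, and $F_c(x) = f(x) + c\varphi(x)$, $x\in X$, $c \ge 0$. The penalized problem is: minimize $F_c(x)$ subject to $x \in Q$. $(\mathcal{P})$ is Levitin-Polyak well-posed in the extended sense if $\operatorname{argmin}(\mathcal{P}) \neq \emptyset$ and for any sequence $\{x_n\}\subset X$ such that $f(x_n)\to f_*$ and $\operatorname{dist}(x_n,\Omega)\to 0$ there exists a subsequence converging to some $x_* \in \operatorname{argmin}(\mathcal{P})$. $F_c$ is nondegenerate in the extended sense if there exists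 $c_0 \ge 0$ such that for any $c \ge c_0$ the function $F_c$ attains a global minimum on $Q$ and there exists $x(c) \in \operatorname{argmin}_{x \in Q} F_c(x)$ such that $\operatorname{dist}(x(c),\Omega) \to 0$ as $c \to \infty$. $F_c$ is globally exact if there exists $c_* \ge 0$ such that for any $c \ge c_*$ the sets of globally optimal solutions of $(\mathcal{P})$ and of the penalized problem coincide. $F_c$ is locally exact at a locally optimal solution $x_*$ of $(\mathcal{P})$ if there exists $c_* \ge 0$ such that for any $c\ge c_*$ the point $x_*$ is a locally optimal solution of the penalized problem. *)

(* Defs.v *)
From HB Require Import structures.
From mathcomp Require Import all_boot all_order all_algebra.
From mathcomp Require Import all_classical all_reals all_analysis.

Set Implicit Arguments.
Unset Strict Implicit.
Unset Printing Implicit Defensive.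

Import Order.TTheory GRing.Theory Num.Theory.
Import numFieldNormedType.Exports.

Local Open Scope classical_set_scope.
Local Open Scope ring_scope.
Local Open Scope ereal_scope.

Section Penalty.
Context {R : realType} {X : metricType R}.
Implicit Types (f g phi : X -> \bar R) (M Q A V : set X) (x : X) (c : R).

(* Only meaningful for nonempty V: the real infimum of the empty set is 0. *)
Definition dist x V : R := inf [set mdist x y | y in V].

Definition global_min g A : set X :=
  [set x | A x /\ forall y, A y -> g x <= g y].

Definition local_min g A : set X :=
  [set x | A x /\ \forall y \near x, A y -> g x <= g y].

Definition optimal_value f M Q : \bar R := ereal_inf [set f x | x in M `&` Q].

Definition infeasibility_measure phi M Q : Prop :=
  (forall x, 0 <= phi x) /\ (forall x, Q x -> (phi x = 0 <-> M x)).

(* At c = 0 and phi x = +oo the product is 0 * +oo = 0, so penalty f phi 0 = f. *)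
Definition penalty f phi c : X -> \bar R := fun x => f x + c%:E * phi x.

Definition LP_well_posed_ext f M Q : Prop :=
  global_min f (M `&` Q) !=set0 /\
  forall u : nat -> X,
    f (u n) @[n --> \oo] --> optimal_value f M Q ->
    dist (u n) (M `&` Q) @[n --> \oo] --> 0%R ->
    exists (s : nat -> nat) (xs : X),
      [/\ {homo s : i j / (i < j)%N},
          global_min f (M `&` Q) xs &
          u (s n) @[n --> \oo] --> xs].

Definition zero_duality_gap f phi M Q : Prop :=
  ereal_sup [set ereal_inf [set penalty f phi c x | x in Q]
            | c in [set c : R | (0 <= c)%R]] = optimal_value f M Q.

Definition nondegenerate_ext f phi M Q : Prop :=
  exists c0 : R, [/\ (0 <= c0)%R,
    forall c, (c0 <= c)%R -> global_min (penalty f phi c) Q !=set0 &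
    exists xc : R -> X,
      (forall c, (c0 <= c)%R -> global_min (penalty f phi c) Q (xc c)) /\
      dist (xc c) (M `&` Q) @[c --> +oo%R] --> 0%R].

Definition globally_exact f phi M Q : Prop :=
  exists2 cs : R, (0 <= cs)%R &
    forall c, (cs <= c)%R ->
      global_min f (M `&` Q) = global_min (penalty f phi c) Q.

Definition locally_exact_at f phi Q x : Prop :=
  exists2 cs : R, (0 <= cs)%R &
    forall c, (cs <= c)%R -> local_min (penalty f phi c) Q x.

End Penalty.

(* Main.v *)
Require Import Defs.
From HB Require Import structures.
From mathcomp Require Import all_boot all_order all_algebra.
From mathcomp Require Import all_classical all_reals all_analysis.
From mathcomp Require Import lra.

(** If [F_c] is exact, an optimal solution [x] of (P) minimizes every [F_c] with
[c] large, and [F_c x = f_*]; the three conditions follow.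

Conversely, let [x(c)] be the minimizers given by nondegeneracy. Since
[f = 2 F_{c/2} - F_c], [F_c (x(c)) <= f_*] and [inf_Q F_{c/2}] tends to [f_*],
the values [f (x(c))] tend to [f_*]. Well-posedness then yields a subsequence
converging to some optimal solution [x_*] of (P). Local exactness at [x_*] for
one parameter [c_*], together with monotonicity of [F_c] in [c], gives
[F_c (x(c)) >= f_*] for some large [c], that is [F_c >= f_*] on [Q]. For larger
parameters a minimizer must have [phi = 0], so the solution sets coincide. *)

Import Order.TTheory GRing.Theory Num.Theory.
Import numFieldNormedType.Exports.

Local Open Scope classical_set_scope.
Local Open Scope ring_scope.
Local Open Scope ereal_scope.

Set Implicit Arguments.
Unset Strict Implicit.

Section PenaltyTheory.
Context {R : realType} {X : metricType R}.
Implicit Types (f phi : X -> \bar R) (M Q V : set X) (x : X) (a b c : R).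

Lemma dist_mem x V : V x -> dist x V = 0%R.
Proof.
move=> Vx; apply/eqP; rewrite eq_le; apply/andP; split.
  apply: ge_inf; last by exists x => //; rewrite mdistxx.
  by exists 0%R => _ [y _ <-]; exact: mdist_ge0.
apply: lb_le_inf; first by exists (mdist x x), x.
by move=> _ [y _ <-]; exact: mdist_ge0.
Qed.

Lemma global_min_optimal_value f M Q x :
  global_min f (M `&` Q) x -> f x = optimal_value f M Q.
Proof.
move=> [Ox fx]; apply/eqP; rewrite eq_le; apply/andP; split.
  by apply: le_ereal_inf_tmp => _ [y Oy <-]; exact: fx.
by apply: ereal_inf_lbound; exists x.
Qed.

Lemma optimal_value_global_min f M Q x :
  (M `&` Q) x -> f x <= optimal_value f M Q -> global_min f (M `&` Q) x.
Proof.
move=> Ox fx; split=> // y Oy; apply: (le_trans fx).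
by apply: ereal_inf_lbound; exists y.
Qed.

Lemma penalty_feasible f phi M Q c x :
  infeasibility_measure phi M Q -> (M `&` Q) x -> penalty f phi c x = f x.
Proof.
move=> [_ phiM] [Mx Qx].
by rewrite /penalty ((phiM x Qx).2 Mx) mule0 adde0.
Qed.

Lemma le_penalty f phi c c' x : 0 <= phi x -> (c <= c')%R ->
  penalty f phi c x <= penalty f phi c' x.
Proof.
by move=> phi0 cc'; rewrite leeD2l// lee_wpmul2r// lee_fin.
Qed.

(** At [c = 0] the convention [0 * +oo = 0] would hide an infinite [phi x]. For [c > 0] a finite
    upper bound excludes [+oo] in both terms, so later comparisons take place in the reals. *)
Lemma penalty_fin f phi c x l : f x != -oo -> 0 <= phi x -> (0 < c)%R ->
  penalty f phi c x <= l%:E ->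
  exists a b, [/\ f x = a%:E, phi x = b%:E & (0 <= b)%R].
Proof.
rewrite /penalty => fx phi0 c0.
case: (f x) fx => [a| |]//= _; last first.
  case: (phi x) phi0 => [b| |]//= _.
  by rewrite gt0_muley ?lte_fin.
case: (phi x) phi0 => [b| |]//= b0; last by rewrite gt0_muley ?lte_fin.
by move=> _; exists a, b; rewrite lee_fin in b0.
Qed.

(* [f = 2 F_c - F_{2c}] wherever the penalty is finite. *)
Lemma penalty_double_lower_bound f phi c x a b l :
  f x = l%:E -> phi x \is a fin_num ->
  a%:E <= penalty f phi c x -> penalty f phi (2 * c) x <= b%:E ->
  (2 * a - b <= l)%R.
Proof.
rewrite /penalty => -> /fineK <-.
by rewrite -!EFinM -!EFinD !lee_fin; nra.
Qed.

(* If [F_c >= f_*] on [Q] and [c < c'], positivity of [phi x] would strictly raise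
   [F_{c'} x] above [f_*], so minimizers of later penalties are feasible. *)
Lemma globally_exact_of_lower_bound f phi M Q c :
  (forall x, f x != -oo) -> optimal_value f M Q \is a fin_num ->
  infeasibility_measure phi M Q -> global_min f (M `&` Q) !=set0 ->
  (0 <= c)%R ->
  (forall x, Q x -> optimal_value f M Q <= penalty f phi c x) ->
  globally_exact f phi M Q.
Proof.
move=> fNy /fineK; set l := fine _ => lE [phi0 phiM] [z zmin] c0 lb.
have cS c' : (c + 1 <= c')%R -> (c < c')%R by lra.
have Fz c' : penalty f phi c' z = l%:E.
  rewrite (@penalty_feasible _ _ M Q)//; last exact: zmin.1.
  by rewrite lE; exact: global_min_optimal_value.
(* Any threshold above [c] would do: it makes [c' - c] positive, which forces [phi x = 0], and [c']
   positive, as [penalty_fin] requires. *)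
exists (c + 1)%R; first by lra.
move=> c' /cS cc'; apply/seteqP; split=> x.
  move=> xmin; split; first exact: xmin.1.2.
  move=> y Qy; rewrite (@penalty_feasible _ _ M Q)//; last exact: xmin.1.
  rewrite (global_min_optimal_value xmin) (le_trans (lb y Qy))//.
  by apply: le_penalty => //; exact: ltW.
move=> [Qx xmin]; have := xmin z zmin.1.2; rewrite Fz => Fx.
have [|a [b [fx phix b0]]] := penalty_fin (fNy x) (phi0 x) _ Fx; first by lra.
have := lb x Qx; rewrite -lE; move: Fx.
rewrite /penalty fx phix -!EFinM -!EFinD !lee_fin => Fx lx.
have b_eq0 : b = 0%R by nra.
apply: optimal_value_global_min.
  by split=> //; apply/phiM => //; rewrite phix b_eq0.
by rewrite fx -lE lee_fin; move: Fx; rewrite b_eq0; lra.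
Qed.

Lemma exact_penalty_inf f phi M Q c x :
  infeasibility_measure phi M Q -> global_min f (M `&` Q) x ->
  global_min f (M `&` Q) = global_min (penalty f phi c) Q ->
  ereal_inf [set penalty f phi c y | y in Q] = optimal_value f M Q.
Proof.
move=> phiM xmin eqmin.
rewrite -(global_min_optimal_value xmin) -(penalty_feasible f c phiM xmin.1).
have [Qx Fx] : global_min (penalty f phi c) Q x by rewrite -eqmin.
apply/eqP; rewrite eq_le; apply/andP; split.
  by apply: ereal_inf_lbound; exists x.
by apply: le_ereal_inf_tmp => _ [y Qy <-]; exact: Fx.
Qed.

(** Weak duality bounds every dual value by [f_*], and the dual value at the exactness threshold
    [cs] already attains it. *)
Lemma globally_exact_zero_duality_gap f phi M Q :
  infeasibility_measure phi M Q -> global_min f (M `&` Q) !=set0 ->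
  globally_exact f phi M Q -> zero_duality_gap f phi M Q.
Proof.
move=> phiM [x xmin] [cs cs0 exact]; rewrite /zero_duality_gap.
have eq_cs := exact_penalty_inf phiM xmin (exact _ (lexx cs)).
apply/eqP; rewrite eq_le; apply/andP; split.
  apply: ge_ereal_sup => _ [c c0 <-].
  rewrite -(global_min_optimal_value xmin) -(penalty_feasible f c phiM xmin.1).
  by apply: ereal_inf_lbound; exists x => //; exact: xmin.1.2.
by apply: ereal_sup_ubound; exists cs.
Qed.

Lemma globally_exact_nondegenerate f phi M Q :
  global_min f (M `&` Q) !=set0 ->
  globally_exact f phi M Q -> nondegenerate_ext f phi M Q.
Proof.
move=> [x xmin] [cs cs0 exact].
have xmin_c c : (cs <= c)%R -> global_min (penalty f phi c) Q x.
  by move=> /exact <-.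
exists cs; split=> // [c /xmin_c xc|]; first by exists x.
exists (fun=> x); split=> //.
by rewrite (dist_mem xmin.1); exact: cvg_cst.
Qed.

Lemma globally_exact_locally_exact f phi M Q x :
  global_min f (M `&` Q) x ->
  globally_exact f phi M Q -> locally_exact_at f phi Q x.
Proof.
move=> xmin [cs cs0 exact]; exists cs => // c csc.
have [Qx Fx] : global_min (penalty f phi c) Q x by rewrite -exact.
by split=> //; exact: nearW.
Qed.

Lemma penalty_minimizer_le f phi M Q c x :
  infeasibility_measure phi M Q -> global_min (penalty f phi c) Q x ->
  penalty f phi c x <= optimal_value f M Q.
Proof.
move=> phiM [_ xmin]; apply: le_ereal_inf_tmp => _ [y Oy <-].
by rewrite -(penalty_feasible f c phiM Oy); apply: xmin; exact: Oy.2.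
Qed.

Lemma cvg_penalty_minimizers f phi M Q (c : nat -> R) (u : nat -> X) :
  (forall x, f x != -oo) -> optimal_value f M Q \is a fin_num ->
  infeasibility_measure phi M Q -> zero_duality_gap f phi M Q ->
  (forall n, global_min (penalty f phi (c n)) Q (u n)) ->
  c n @[n --> \oo] --> +oo%R ->
  f (u n) @[n --> \oo] --> optimal_value f M Q.
Proof.
move=> fNy lfin phiM gap umin cy; have phi0 := phiM.1.
move: (lfin) => /fineK; set l := fine _ => lE.
have Fu n : penalty f phi (c n) (u n) <= l%:E.
  by rewrite lE; exact: penalty_minimizer_le.
have fu_fin : \forall n \near \oo, exists a b,
    [/\ f (u n) = a%:E, phi (u n) = b%:E & (0 <= b)%R].
  move/cvgryPgt : cy => /(_ 0%R); apply: filterS => n cn0.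
  exact: penalty_fin (Fu n).
rewrite -lE; apply/fine_cvgP; split.
  by apply: filterS fu_fin => n [a [b [-> _ _]]].
apply/cvgrPdist_le => e e0.
(* The slack [e / 2] gets doubled in [2 F_{c/2} - F_c]: [2 * (l - e / 2) - l = l - e]. *)
have : ((l - e / 2)%:E < ereal_sup [set ereal_inf [set penalty f phi c x | x in Q]
            | c in [set c : R | (0 <= c)%R]]).
  by rewrite gap -lE lte_fin; lra.
move=> /ereal_sup_gt[_ [d d0 <-] ld].
(* Once [c n >= 2 * d], the half parameter [c n / 2] is at least [d], so the dual bound at [d]
   carries over to it. *)
move/cvgryPge : cy => /(_ (2 * d)%R) c_ge.
apply: filterS2 fu_fin c_ge => n [a [b [fu phiu b0]]] dc.
have lbu : (l - e / 2)%:E <= penalty f phi (c n / 2)%R (u n).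
  apply: (le_trans (ltW ld)); apply: (@le_trans _ _ (penalty f phi d (u n))).
    by apply: ereal_inf_lbound; exists (u n) => //; exact: (umin n).1.
  by apply: le_penalty => //; lra.
have c2 : (2 * (c n / 2) = c n)%R by lra.
have := Fu n; rewrite -[X in penalty _ _ X]c2 => ubu.
have := penalty_double_lower_bound fu _ lbu ubu.
rewrite phiu => /(_ isT) al.
have : a%:E <= l%:E.
  rewrite -fu; apply: le_trans (Fu n).
  by rewrite leeDl// mule_ge0// lee_fin /=; simpl in d0; lra.
rewrite lee_fin /= fu /= => la.
by rewrite ger0_norm; lra.
Qed.

Lemma LP_penalty_lower_bound f phi M Q :
  (forall x, f x != -oo) -> optimal_value f M Q \is a fin_num ->
  infeasibility_measure phi M Q -> LP_well_posed_ext f M Q ->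
  zero_duality_gap f phi M Q -> nondegenerate_ext f phi M Q ->
  (forall x, global_min f (M `&` Q) x -> locally_exact_at f phi Q x) ->
  exists2 c : R, (0 <= c)%R &
    forall x, Q x -> optimal_value f M Q <= penalty f phi c x.
Proof.
move=> fNy lfin phiM [_ LP] gap [c0 [c0_ge0 _ [xc [xcmin xc_dist]]]] loc.
(* Starting at [c0] guarantees that every [xc (c n)] is a minimizer. *)
pose c (n : nat) : R := (c0 + n%:R)%R.
have c_ge n : (c0 <= c n)%R by rewrite /c lerDl.
have cy : c n @[n --> \oo] --> +oo%R.
  apply/cvgryPge => A; have [N _ NA] := nbhs_infty_ger A.
  by exists N => // n /NA /= An; rewrite (le_trans An)// /c lerDr.
have umin n : global_min (penalty f phi (c n)) Q (xc (c n)) by exact: xcmin.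
have fu := cvg_penalty_minimizers fNy lfin phiM gap umin cy.
have du : dist (xc (c n)) (M `&` Q) @[n --> \oo] --> 0%R.
  exact: (cvg_comp c (fun r => dist (xc r) (M `&` Q)) cy xc_dist).
have [s [xs [smono xsmin ucvg]]] := LP _ fu du.
have [cs cs0 /(_ _ (lexx cs)) [_ xsloc]] := loc xs xsmin.
(* This makes the parameters [c (s n)] along the subsequence unbounded, so they eventually exceed
   [cs]. *)
have s_ge n : (n <= s n)%N.
  by elim: n => // n IH; exact: (leq_ltn_trans IH (smono _ _ (ltnSn n))).
have near_xs : \forall n \near \oo, Q (xc (c (s n))) ->
    penalty f phi cs xs <= penalty f phi cs (xc (c (s n))).
  exact: ucvg xsloc.
have near_cs : \forall n \near \oo, (cs <= c (s n))%R.
  have [N _ NA] := nbhs_infty_ger cs.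
  exists N => // n /NA /= csn; apply: (le_trans csn).
  apply: (@le_trans _ _ (s n)%:R%R); first by rewrite ler_nat.
  by rewrite /c lerDr.
(* A single such index suffices. With [u = xc (c (s n))], every [x] in [Q] satisfies [F_{c (s n)} x
   >= F_{c (s n)} u >= F_cs u >= F_cs xs = f_*]. *)
have [n [xsn csn]] := filter_ex (filterI near_xs near_cs).
exists (c (s n)); first exact: le_trans (c_ge _).
move=> x Qx; apply: le_trans ((umin (s n)).2 x Qx).
rewrite -(global_min_optimal_value xsmin) -(penalty_feasible f cs phiM xsmin.1).
apply: (le_trans (xsn (umin (s n)).1)).
by apply: le_penalty => //; exact: phiM.1.
Qed.

End PenaltyTheory.

Theorem corollary4 (R : realType) (X : metricType R) (M Q : set X)
    (f phi : X -> \bar R)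
    (M0 : M !=set0) (Q0 : Q !=set0)
    (f_Ny : forall x, f x != -oo)
    (Omega0 : M `&` Q !=set0)
    (fstar_fin : optimal_value f M Q \is a fin_num)
    (phi_meas : infeasibility_measure phi M Q)
    (LP : LP_well_posed_ext f M Q) :
  globally_exact f phi M Q <->
  [/\ zero_duality_gap f phi M Q,
      nondegenerate_ext f phi M Q &
      forall x, global_min f (M `&` Q) x -> locally_exact_at f phi Q x].
Proof.
have [minP _] := LP; split=> [exact | [gap nondeg loc]].
  split; [exact: globally_exact_zero_duality_gap |
          exact: globally_exact_nondegenerate |].
  by move=> x xmin; exact: globally_exact_locally_exact xmin exact.
have [c c0 lb] :=
  LP_penalty_lower_bound f_Ny fstar_fin phi_meas LP gap nondeg loc.
exact: (globally_exact_of_lower_bound (c := c)).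
Qed.
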